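(* Let $\Omega\subset\mathbb{R}^d$ be an open set, let the density $\rho$ and the stiffness $k$ be constants, let $c:=k^{-1}$ be the compliance, and let $\Delta t$ be the time step. Let $V_{h,0}\subset H_0(\mathrm{grad})$ and $\boldsymbol W_h\subset L^2(\Omega;\mathbb{R}^d)$ be finite element spaces satisfying the compatibility condition $$\boldsymbol W_h\subset\nabla V_{h,0}.$$ Consider the following two schemes. (L) The Störmer-Verlet scheme for the Lagrangian description, with unknowns $v_{h,L}^{n+\frac12},\,q_{h,L}^n\in V_{h,0}$: $$(\psi_h,\rho(v_{h,L}^{n+\frac12}-v_{h,L}^{n-\frac12}))_\Omega=-\Delta t\,(\nabla\psi_h,k\nabla q_{h,L}^n)_\Omega\quad\text{for all }\psi_h\in V_{h,0},$$ $$q_{h,L}^{n+1}-q_{h,L}^n=\Delta t\,v_{h,L}^{n+\frac12}.$$ (M) The Störmer-Verlet scheme for the mixed formulation, with unknowns $v_{h,M}^{n+\frac12}\in V_{h,0}$ and $\boldsymbol\sigma_{h,M}^n\in\boldsymbol W_h$: $$(\psi_h,\rho(v_{h,M}^{n+\frac12}-v_{h,M}^{n-\frac12}))_\Omega=-\Delta t\,(\nabla\psi_h,\boldsymbol\sigma_{h,M}^n)_\Omega\quad\text{for all }\psi_h\in V_{h,0},$$ $$(\boldsymbol\xi_h,c(\boldsymbol\sigma_{h,M}^{n+1}-\boldsymbol\sigma_{h,M}^n))_\Omega=\Delta t\,(\boldsymbol\xi_h,\nabla v_{h,M}^{n+\frac12})_\Omega\quad\text{for all }\boldsymbol\xi_h\in\boldsymbol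 W_h.$$ Suppose that $\boldsymbol\sigma_{h,M}^0=k\nabla q_{h,L}^0$ and that the field $q_{h,M}^{n+1}$, with $q_{h,M}^0=q_{h,L}^0$, is reconstructed via the trapezoidal rule $$q_{h,M}^{n+1}=q_{h,M}^n+\frac{\Delta t}{2}\,(v_{h,M}^n+v_{h,M}^{n+1}).$$ Then the formulations (L) and (M) are equivalent.
   Context: The schemes discretize the linear wave equation $\rho\ddot q=\nabla\cdot(k\nabla q)$ with $q|_{\partial\Omega}=0$, where $v=\dot q$ is the velocity and $\boldsymbol\sigma=k\nabla q$ is the stress. $(\cdot,\cdot)_\Omega$ is the $L^2(\Omega)$ inner product of scalar or vector fields. $H_0(\mathrm{grad})$ is the space of $u\in L^2(\Omega)$ with $\nabla u\in L^2$ satisfying the homogeneous Dirichlet condition, and $\nabla V_{h,0}=\{\nabla w: w\in V_{h,0}\}$. A superscript $n$ refers to time $n\Delta t$. The subscripts $L$ and $M$ stand for the Lagrangian and mixed descriptions. The average $\tfrac12(v_{h,M}^n+v_{h,M}^{n+1})$ in the trapezoidal rule is identified with $v_{h,M}^{n+\frac12}$. Equivalence is meant in the sense that $\boldsymbol\sigma_{h,M}^n=k\nabla q_{h,L}^n$ for all $n$, so that the velocity equations of (L) and (M) are the same, while the update of $q$ is the same by the assumed reconstruction.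
   Formalization: The compatibility condition is reversed to ∇V_{h,0} ⊂ W_h, since the printed W_h ⊂ ∇V_{h,0} fails (e.g. W_h = {0} with nonzero initial velocity); agreement of solutions also assumes equal starting velocities v^{-1/2}, and ρ, k are assumed nonzero. *)

(* Defs.v *)
From HB Require Import structures.
From mathcomp Require Import all_boot all_order all_algebra.
From mathcomp Require Import all_classical all_reals all_analysis.

Set Implicit Arguments.
Unset Strict Implicit.
Unset Printing Implicit Defensive.

Import Order.TTheory GRing.Theory Num.Theory.
Import numFieldNormedType.Exports.

Local Open Scope classical_set_scope.
Local Open Scope ring_scope.

(* Coordinatewise (product) sigma-algebra on R^d. *)
Section rV_measurable.
Variables (R : realType) (d : nat).

Definition rV_coord (i : 'I_d) (x : 'rV[R]_d) : R := x 0 i.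

Let rV_set0 : g_sigma_preimage rV_coord set0.
Proof. exact: sigma_algebra0. Qed.

Let rV_setC A : g_sigma_preimage rV_coord A -> g_sigma_preimage rV_coord (~` A).
Proof. exact: sigma_algebraC. Qed.

Let rV_bigcup (F : _^nat) : (forall i, g_sigma_preimage rV_coord (F i)) ->
  g_sigma_preimage rV_coord (\bigcup_i (F i)).
Proof. exact: sigma_algebra_bigcup. Qed.

HB.instance Definition _ := @isMeasurable.Build
  (measure_tuple_display default_measure_display)
  'rV[R]_d (g_sigma_preimage rV_coord) rV_set0 rV_setC rV_bigcup.

Lemma measurable_rV_coord (i : 'I_d) : measurable_fun setT (rV_coord i).
Proof.
move=> _ Y mY; rewrite setTI; apply: sub_sigma_algebra => /=.
rewrite -bigcup_seq/=; exists i => /=; first by rewrite mem_index_enum.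
by exists Y => //; rewrite setTI.
Qed.

Lemma measurable_fun_rV d1 (T : measurableType d1) (f : T -> 'rV[R]_d) :
  (forall i, measurable_fun setT (fun x => f x 0 i)) -> measurable_fun setT f.
Proof.
move=> mf; suff H : (measurable : set (set 'rV[R]_d)) `<=`
    [set A | measurable (f @^-1` A)].
  by move=> _ A mA; rewrite setTI; exact: H.
apply: smallest_sub.
  split=> /=.
  - by rewrite preimage_set0.
  - by move=> B mB; rewrite setTD preimage_setC; exact: measurableC.
  - by move=> F mF; rewrite preimage_bigcup; exact: bigcup_measurable.
rewrite -bigcup_seq => B [i _] [C mC <-] /=.
by rewrite setTI; have := mf i measurableT _ mC; rewrite setTI.
Qed.

End rV_measurable.

Section lebesgue_rV.
Variable R : realType.

Definition rV_cons n (p : measurableTypeR R * 'rV[R]_n) : 'rV[R]_n.+1 :=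
  row_mx (p.1)%:M p.2.

Definition rV_uncons n (x : 'rV[R]_n.+1) :
    measurableTypeR R * 'rV[R]_n :=
  (x 0 ord0, @rsubmx _ 1 1 n x).

Lemma rV_consK n : cancel (@rV_cons n) (@rV_uncons n).
Proof.
move=> [a v]; rewrite /rV_cons /rV_uncons /= row_mxKr; congr pair.
have -> : (ord0 : 'I_n.+1) = lshift n (ord0 : 'I_1) by exact/val_inj.
by apply: (etrans (row_mxEl _ _ _ _)); rewrite mxE eqxx mulr1n.
Qed.

Lemma measurable_rV_cons n : measurable_fun setT (@rV_cons n).
Proof.
apply: measurable_fun_rV => i.
case: (@splitP 1 n i) => j ij.
  have {ij}-> : i = lshift n j by exact/val_inj.
  apply: (eq_measurable_fun fst); last exact: measurable_fst.
  move=> p _; rewrite /rV_cons; apply/esym.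
  by apply: (etrans (row_mxEl _ _ _ _)); rewrite mxE !ord1 eqxx mulr1n.
have {ij}-> : i = rshift 1 j by exact/val_inj.
apply: (eq_measurable_fun (rV_coord j \o snd)).
  by move=> p _; apply/esym; exact: row_mxEr.
by apply: measurableT_comp => //; exact: measurable_rV_coord.
Qed.

Lemma measurable_rV_uncons n : measurable_fun setT (@rV_uncons n).
Proof.
apply: measurable_fun_pair => /=; first exact: (measurable_rV_coord ord0).
apply: measurable_fun_rV => i.
apply: (eq_measurable_fun (@rV_coord R n.+1 (rshift 1 i))).
  by move=> x _; rewrite mxE.
exact: measurable_rV_coord.
Qed.

Section step.
Variables (n : nat)
  (m : {sigma_finite_measure set 'rV[R]_n -> \bar R}).


Definition lebesgue_cons : set 'rV[R]_n.+1 -> \bar R :=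
  pushforward (lebesgue_measure \x m)%E (@rV_cons n).


Let lebesgue_cons0 : lebesgue_cons set0 = 0%E.
Proof. by rewrite /lebesgue_cons /pushforward preimage_set0 measure0. Qed.

Let lebesgue_cons_ge0 A : (0 <= lebesgue_cons A)%E.
Proof. by rewrite /lebesgue_cons /pushforward measure_ge0. Qed.

Let lebesgue_cons_sigma_additive : semi_sigma_additive lebesgue_cons.
Proof.
exact: (@measure_semi_sigma_additive _ _ _
  (measure_function_pushforward__canonical__measure_function_Measure
    _ (@measurable_rV_cons n))).
Qed.

HB.instance Definition _ := isMeasure.Build _ _ _ lebesgue_cons
  lebesgue_cons0 lebesgue_cons_ge0 lebesgue_cons_sigma_additive.

Let lebesgue_cons_sigma_finite : sigma_finite setT lebesgue_cons.
Proof.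
have /sigma_finiteP[F [TF ndF Foo]] := sigma_finiteT (@lebesgue_measure R).
have /sigma_finiteP[G [TG ndG Goo]] := sigma_finiteT m.
exists (fun k => @rV_uncons n @^-1` (F k `*` G k)) => [|k].
  rewrite -preimage_bigcup (_ : \bigcup_k _ = setT) ?preimage_setT//.
  apply/seteqP; split=> // -[x y] _.
  have [[k _ Fkx] [l _ Gly]] : (\bigcup_k F k) x /\ (\bigcup_k G k) y.
    by rewrite -TF -TG.
  exists (maxn k l) => //; split.
  - by move: x Fkx; exact/subsetPset/ndF/leq_maxl.
  - by move: y Gly; exact/subsetPset/ndG/leq_maxr.
have [mF Fk] := Foo k; have [mG Gk] := Goo k.
split.
  rewrite -[X in measurable X]setTI; apply: measurable_rV_uncons => //.
  exact: measurableX.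
rewrite /lebesgue_cons /pushforward -comp_preimage.
rewrite (_ : _ \o _ = id); last by apply/funext => p; exact: rV_consK.
by rewrite preimage_id product_measure1E// lte_mul_pinfty// ge0_fin_numE.
Qed.

HB.instance Definition _ :=
  Measure_isSigmaFinite.Build _ _ _ lebesgue_cons lebesgue_cons_sigma_finite.

End step.

(* Lebesgue measure on R^n, see lebesgue_rV_box. *)
Fixpoint lebesgue_rV n : {sigma_finite_measure set 'rV[R]_n -> \bar R} :=
  match n with
  | 0 => dirac (0 : 'rV[R]_0)
  | n'.+1 => lebesgue_cons (lebesgue_rV n')
  end.

Lemma measurable_rV_box n (a b : 'rV[R]_n) :
  measurable [set x : 'rV[R]_n | forall i, a 0 i <= x 0 i <= b 0 i].
Proof.
have -> : [set x : 'rV[R]_n | forall i, a 0 i <= x 0 i <= b 0 i] =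
    \big[setI/setT]_(i < n) (rV_coord i @^-1` `[a 0 i, b 0 i]%classic).
  rewrite -bigcap_seq; apply/seteqP; split=> x /= H i.
    by move=> _; rewrite /= in_itv/=; exact: H.
  by have := H i (mem_index_enum _); rewrite /= in_itv.
apply: bigsetI_measurable => i _.
by rewrite -[X in measurable X]setTI; exact: measurable_rV_coord.
Qed.

Lemma lebesgue_rV_box n (a b : 'rV[R]_n) : (forall i, a 0 i <= b 0 i) ->
  lebesgue_rV n [set x : 'rV[R]_n | forall i, a 0 i <= x 0 i <= b 0 i] =
  (\prod_(i < n) (b 0 i - a 0 i))%:E.
Proof.
elim: n a b => [|n IH] a b ab.
  by rewrite /= diracE mem_set ?big_ord0// => -[].
pose a' := @rsubmx _ 1 1 n a; pose b' := @rsubmx _ 1 1 n b.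
have aE i : a' 0 i = a 0 (lift ord0 i).
  by rewrite mxE; congr (a _ _); exact/val_inj.
have bE i : b' 0 i = b 0 (lift ord0 i).
  by rewrite mxE; congr (b _ _); exact/val_inj.
rewrite /= /lebesgue_cons /pushforward.
have -> : @rV_cons n @^-1` [set x | forall i, a 0 i <= x 0 i <= b 0 i] =
    `[a 0 ord0, b 0 ord0]%classic `*`
    [set x : 'rV[R]_n | forall i, a' 0 i <= x 0 i <= b' 0 i].
  have c0 (p : measurableTypeR R * 'rV[R]_n) : @rV_cons n p 0 ord0 = p.1 by exact: (congr1 fst (rV_consK p)).
  have cS (p : measurableTypeR R * 'rV[R]_n) i : @rV_cons n p 0 (lift ord0 i) = p.2 0 i.
    have -> : p.2 = @rsubmx _ 1 1 n (rV_cons p).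
      exact: (congr1 snd (esym (rV_consK p))).
    have e : lift ord0 i = rshift 1 i :> 'I_n.+1 by exact/val_inj.
    by rewrite e; apply/esym; exact: (mxE _ _ 0 i).
  apply/seteqP; split=> -[x v] /=.
    move=> H; split; first by rewrite in_itv/=; have := H ord0; rewrite c0.
    by move=> i; rewrite aE bE; have := H (lift ord0 i); rewrite cS.
  move=> [Hx Hv] i; case: (unliftP ord0 i) => [j|] ->.
    by rewrite cS -aE -bE.
  by rewrite c0; move: Hx; rewrite in_itv.
rewrite product_measure1E//; last exact: measurable_rV_box.
rewrite IH => [|i]; last by rewrite aE bE.
rewrite big_ord_recl EFinM.
congr (_ * _)%E; last by congr EFin; apply: eq_bigr => i _; rewrite aE bE.
apply: (etrans (lebesgue_measure_itv _)); rewrite /= lte_fin.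
by case: ltgtP (ab ord0) => // -> _; rewrite subrr.
Qed.

End lebesgue_rV.

Section function_spaces.
Variables (R : realType) (d : nat) (Omega : set 'rV[R]_d).

Local Notation scalar_field := ('rV[R]_d -> R).
Local Notation vector_field := ('rV[R]_d -> 'rV[R]_d).

(* Elements of L2 spaces are represented by functions; only their values on
   Omega matter, and two of them are identified when equal a.e. in Omega. *)
Definition eq_on (T : Type) (f g : 'rV[R]_d -> T) : Prop :=
  f = g %[ae lebesgue_rV R d in Omega].

Definition L2 : set scalar_field :=
  [set u | u \_ Omega \in Lfun (lebesgue_rV R d) 2%:E].

Definition L2v : set vector_field :=
  [set g | forall i, L2 (fun x => g x 0 i)].

Definition dotL2 (u v : scalar_field) : R :=
  (\int[lebesgue_rV R d]_(x in Omega) (u x * v x))%R.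

Definition dotL2v (f g : vector_field) : R :=
  (\int[lebesgue_rV R d]_(x in Omega) \sum_(i < d) f x 0 i * g x 0 i)%R.

Definition partial (i : 'I_d) (phi : scalar_field) : scalar_field :=
  fun x => 'D_(delta_mx 0 i) phi x.

Definition classical_grad (phi : scalar_field) : vector_field :=
  fun x => \row_i partial i phi x.

(* All iterated partial derivatives are differentiable, hence continuous. *)
Definition smooth (phi : scalar_field) : Prop :=
  forall (s : seq 'I_d) x, differentiable (foldr partial phi s) x.

Definition test_function : set scalar_field :=
  [set phi | [/\ smooth phi, compact (closure [set x | phi x != 0]) &
                 closure [set x | phi x != 0] `<=` Omega]].

Definition is_weak_grad (u : scalar_field) (g : vector_field) : Prop :=
  L2v g /\ forall phi, test_function phi -> forall i,
    dotL2 u (partial i phi) = - dotL2 (fun x => g x 0 i) phi.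

(* A representative of the weak gradient, whenever it exists in L2. *)
Definition grad (u : scalar_field) : vector_field :=
  xget (fun=> 0) [set g | is_weak_grad u g].

(* Omega has no regularity, so the homogeneous Dirichlet condition is
   understood as usual: closure of the test functions in the H1 norm. *)
Definition H0_grad : set scalar_field :=
  [set u | [/\ L2 u, is_weak_grad u (grad u) &
    exists phi : nat -> scalar_field,
      [/\ forall n, test_function (phi n),
          dotL2 (phi n \- u) (phi n \- u) @[n --> \oo] --> (0 : R) &
          dotL2v (classical_grad (phi n) \- grad u)
                 (classical_grad (phi n) \- grad u) @[n --> \oo] --> (0 : R)]]].

(* A finite-dimensional subspace of X (X is L2 or L2v), closed under
   equality a.e. in Omega. *)
Definition fe_space (F : lmodType R) (X V : set ('rV[R]_d -> F)) : Prop :=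
  exists m (b : 'I_m -> 'rV[R]_d -> F), (forall i, X (b i)) /\
    V = [set u | X u /\ exists a : 'I_m -> R,
                   eq_on u (fun x => \sum_i a i *: b i x)].

End function_spaces.

(* Half-integer times: v n stands for the velocity at time (n - 1/2) dt. *)
Section schemes.
Variables (R : realType) (d : nat) (Omega : set 'rV[R]_d).
Variables (V : set ('rV[R]_d -> R)) (W : set ('rV[R]_d -> 'rV[R]_d)).
Variables (rho k dt : R).

Local Notation grad := (grad Omega).

(* This inclusion makes the weak stress update of the mixed scheme hold
   pointwise.  The reverse inclusion alone would not do: when some grad w,
   w in V, is not in W, the L2 projection onto W of grad w differs from it and
   the two schemes started with the velocity w differ after one step. *)
Definition compatible : Prop := [set grad w | w in V] `<=` W.

Definition lagrangian_scheme (v q : nat -> 'rV[R]_d -> R) : Prop :=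
  [/\ forall n, V (v n),
      forall n, V (q n),
      forall n psi, V psi ->
        dotL2 Omega psi (rho \*o (v n.+1 \- v n)) =
        - dt * dotL2v Omega (grad psi) (fun x => k *: grad (q n) x) &
      forall n, eq_on Omega (q n.+1 \- q n) (dt \*o v n.+1)].

Definition mixed_scheme (v : nat -> 'rV[R]_d -> R)
    (sigma : nat -> 'rV[R]_d -> 'rV[R]_d) : Prop :=
  [/\ forall n, V (v n),
      forall n, W (sigma n),
      forall n psi, V psi ->
        dotL2 Omega psi (rho \*o (v n.+1 \- v n)) =
        - dt * dotL2v Omega (grad psi) (sigma n) &
      forall n xi, W xi ->
        dotL2v Omega xi (fun x => k^-1 *: (sigma n.+1 x - sigma n x)) =
        dt * dotL2v Omega xi (grad (v n.+1))].

(* vbar n is the velocity at the integer time n dt. *)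
Definition trapezoidal_reconstruction (v vbar q : nat -> 'rV[R]_d -> R) : Prop :=
  [/\ forall n, V (vbar n),
      forall n, V (q n),
      forall n, eq_on Omega (fun x => (vbar n x + vbar n.+1 x) / 2) (v n.+1) &
      forall n, eq_on Omega (q n.+1)
        (fun x => q n x + dt / 2 * (vbar n x + vbar n.+1 x))].

End schemes.

(* Main.v *)
Require Import Defs.
From mathcomp Require Import all_boot all_order all_algebra.
From mathcomp Require Import all_classical all_reals all_analysis.
From mathcomp Require Import measurable_realfun.
From mathcomp Require Import ring lra.

Set Implicit Arguments.
Unset Strict Implicit.
Unset Printing Implicit Defensive.

Import Order.TTheory GRing.Theory Num.Theory.
Import numFieldNormedType.Exports.

Local Open Scope classical_set_scope.
Local Open Scope ring_scope.

(** The weak stress update of the mixed scheme is in fact a pointwise one. The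
    compatibility condition puts the gradient of every velocity in W, so that the
    residual sigma' - sigma - k dt grad v is an admissible test field xi, and
    testing the weak equation with it shows that it vanishes a.e.
    ([strong_stress_update]). On the other hand, k times the gradient of the
    position update is k grad q' = k grad q + k dt grad v. Both schemes thus update
    sigma and k grad q in the same way, and sigma = k grad q holds at all times once
    it holds initially ([stress_propagates]). The velocity equations are then the
    same, and determine the new velocity ([velocity_update_unique]); the position
    updates are the same because the trapezoidal rule averages integer-time
    velocities to half-integer ones ([trapezoidal_position]).

    The analytic point is that k grad q' can be expanded: grad u is a chosen
    representative of the weak gradient, and it is linear in u, up to equality
    a.e., only because weak gradients are unique. Uniqueness is obtained here for
    fields of H0 without any mollification ([grad_comb]). A combination g of such
    gradients whose potentials cancel is orthogonal to all test functions; but it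
    is also an L2 limit of partial derivatives of test functions, which are test
    functions; hence g is orthogonal to itself. For this argument test functions
    have to be square integrable ([test_function_L2]), which rests on the
    measurability of open sets for the coordinate sigma-algebra
    ([open_measurable_rV]). *)

(** * The inner products of scalar and vector fields *)

Section scalar_L2.
Variables (R : realType) (d : nat) (Omega : set 'rV[R]_d).
Local Notation mu := (lebesgue_rV R d).
Implicit Types u v w : 'rV[R]_d -> R.

Lemma L2_comb (a b : R) u v : L2 Omega u -> L2 Omega v ->
  L2 Omega (fun x => a * u x + b * v x).
Proof.
rewrite /L2 /= => Lu Lv.
have p1 : (1 <= 2%:E :> \bar R)%E by rewrite lee_fin ler1n.
have [_ cl] := Lfun_submod_closed mu p1.
have Lv' := cl b _ _ Lv (Lfun_submod_closed mu p1).1.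
suff -> : (fun x => a * u x + b * v x) \_ Omega =
    a *: (u \_ Omega) + (b *: (v \_ Omega) + 0) by exact: cl.
apply/funext => x; rewrite !fctE /= /patch.
by case: ifP => _; rewrite /GRing.scale /= ?mulr0 ?addr0.
Qed.

(** Extending fields by zero moves every integral to the whole space, where square
    integrability is defined. *)
Lemma dotL2_patch u v :
  dotL2 Omega u v = \int[mu]_x ((u \_ Omega) x * (v \_ Omega) x).
Proof.
rewrite /dotL2 Rintegral_mkcond; apply: eq_Rintegral => x _.
by rewrite /patch; case: ifP => _; rewrite ?mulr0.
Qed.

Lemma L2_integrable u v : L2 Omega u -> L2 Omega v ->
  mu.-integrable setT (EFin \o (fun x => (u \_ Omega) x * (v \_ Omega) x)).
Proof. by move=> Lu Lv; apply/Lfun1_integrable; exact: Lfun2_mul_Lfun1. Qed.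

Lemma dotL2C u v : dotL2 Omega u v = dotL2 Omega v u.
Proof. by apply: eq_Rintegral => x _; rewrite mulrC. Qed.

Lemma dotL2_combr (a b : R) u v w : L2 Omega u -> L2 Omega v -> L2 Omega w ->
  dotL2 Omega u (fun x => a * v x + b * w x) =
  a * dotL2 Omega u v + b * dotL2 Omega u w.
Proof.
move=> Lu Lv Lw; have Iv := L2_integrable Lu Lv; have Iw := L2_integrable Lu Lw.
rewrite !dotL2_patch -!RintegralZl// -RintegralD//.
- apply: eq_Rintegral => x _; rewrite /patch.
  by case: ifP => _; rewrite ?mulr0 ?addr0// mulrDr; congr (_ + _);
    exact: mulrCA.
- exact: (integrableZl measurableT a Iv).
- exact: (integrableZl measurableT b Iw).
Qed.

Lemma eq_on_patch u v : eq_on Omega u v -> (u \_ Omega) = (v \_ Omega) %[ae mu].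
Proof.
apply: filterS => x uv _; rewrite /patch; case: ifP => // /set_mem; exact: uv.
Qed.

Lemma dotL2_eq_on u v w : L2 Omega u -> L2 Omega v -> L2 Omega w ->
  eq_on Omega v w -> dotL2 Omega u v = dotL2 Omega u w.
Proof.
move=> Lu Lv Lw /eq_on_patch vw; rewrite !dotL2_patch; congr fine.
apply: ae_eq_integral => //.
- exact: measurable_int (L2_integrable Lu Lv).
- exact: measurable_int (L2_integrable Lu Lw).
- by apply: filterS vw => x xvw _; rewrite xvw.
Qed.

Lemma dotL2_ge0 u : 0 <= dotL2 Omega u u.
Proof. by apply: Rintegral_ge0 => x _; rewrite -expr2 sqr_ge0. Qed.

Lemma dotL2_eq0 u : L2 Omega u -> dotL2 Omega u u = 0 ->
  eq_on Omega u (fun=> 0).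
Proof.
move=> Lu; rewrite dotL2_patch /Rintegral => u0.
have Iu := L2_integrable Lu Lu.
have {u0} : (\int[mu]_x `|((u \_ Omega) x * (u \_ Omega) x)%:E| = 0)%E.
  rewrite -[RHS]/(0%R%:E) -u0 fineK; last exact: integrable_fin_num Iu.
  by apply: eq_integral => x _; rewrite gee0_abs// lee_fin -expr2 sqr_ge0.
move/(ae_eq_integral_abs _ measurableT (measurable_int _ Iu)).
apply: filterS => x /(_ I)[]/eqP; rewrite mulf_eq0 orbb => /eqP + Ox.
by rewrite /patch mem_set.
Qed.

(** Orthogonality passes to L2 limits. With e n the error h n - v, the square
    norm of t u + e n is nonnegative for every real t; in the limit this gives
    2 t <u, v> <= t^2 <u, u> for all t, hence <u, v> = 0. *)
Lemma dotL2_limit u v (h : nat -> 'rV[R]_d -> R) : L2 Omega u -> L2 Omega v ->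
  (forall n, L2 Omega (h n)) -> (forall n, dotL2 Omega u (h n) = 0) ->
  dotL2 Omega (h n \- v) (h n \- v) @[n --> \oo] --> (0 : R) ->
  dotL2 Omega u v = 0.
Proof.
move=> Lu Lv Lh uh0 hv.
pose U := dotL2 Omega u u; pose p := dotL2 Omega u v.
have expand n t : 0 <= t * t * U - 2 * t * p + dotL2 Omega (h n \- v) (h n \- v).
  have Le : L2 Omega (h n \- v).
    have := L2_comb 1 (-1) (Lh n) Lv; congr L2.
    by apply/funext => x /=; rewrite mul1r mulN1r.
  have ue : dotL2 Omega u (h n \- v) = - p.
    rewrite -[LHS](_ : dotL2 Omega u (fun x => 1 * h n x + -1 * v x) = _).
      by rewrite dotL2_combr// uh0 mulr0 add0r mulN1r.
    by congr dotL2; apply/funext => x /=; rewrite mul1r mulN1r.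
  have := dotL2_ge0 (fun x => t * u x + 1 * (h n \- v) x).
  have L := L2_comb t 1 Lu Le.
  rewrite dotL2_combr// (dotL2C _ u) (dotL2C _ (h n \- v)) !dotL2_combr//.
  rewrite ue [dotL2 Omega (h n \- v) u]dotL2C ue -/U.
  by congr (_ <= _); ring.
have lim t : 2 * t * p - t * t * U <= 0.
  apply: (cvgr_to_ge hv); apply: nearW => n.
  by rewrite -subr_ge0; have := expand n t; congr (_ <= _); ring.
have U0 : 0 < U + 1 by rewrite ltr_wpDl// dotL2_ge0.
(* Adding 1 to the square norm of u avoids a division by zero. *)
have := lim (p / (U + 1)).
have -> : 2 * (p / (U + 1)) * p - p / (U + 1) * (p / (U + 1)) * U =
    p ^+ 2 * (U + 2) / (U + 1) ^+ 2 by field; rewrite gt_eqF.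
rewrite pmulr_lle0 ?invr_gt0 ?exprn_gt0// pmulr_lle0; last by lra.
by move=> p0; apply/eqP; rewrite -sqrf_eq0 eq_le p0 sqr_ge0.
Qed.

End scalar_L2.

Lemma Rintegral_sum (disp : measure_display) (X : measurableType disp)
    (R : realType) (m : {measure set X -> \bar R}) (I : Type) (r : seq I)
    (f : I -> X -> R) :
  (forall i, m.-integrable setT (EFin \o f i)) ->
  \int[m]_x (\sum_(i <- r) f i x) = \sum_(i <- r) \int[m]_x f i x.
Proof.
move=> If; elim: r => [|i r IH].
  rewrite big_nil; under eq_Rintegral do rewrite big_nil.
  by rewrite Rintegral_cst// mul0r.
rewrite big_cons -IH -RintegralD//.
  by apply: eq_Rintegral => x _; rewrite big_cons.
rewrite (_ : EFin \o _ = (fun x => \sum_(j <- r) (f j x)%:E)%E).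
  by apply: integrable_sum => // j _; exact: If.
by apply/funext => x; rewrite /= sumEFin.
Qed.

Section vector_L2.
Variables (R : realType) (d : nat) (Omega : set 'rV[R]_d).
Implicit Types f g h : 'rV[R]_d -> 'rV[R]_d.

Lemma L2v_comb (a b : R) f g : L2v Omega f -> L2v Omega g ->
  L2v Omega (fun x => a *: f x + b *: g x).
Proof.
move=> Lf Lg i; have := L2_comb a b (Lf i) (Lg i); congr L2.
by apply/funext => x; rewrite !mxE.
Qed.

Lemma eq_on_coord f g :
  (forall i, eq_on Omega (fun x => f x 0 i) (fun x => g x 0 i)) ->
  eq_on Omega f g.
Proof.
move=> fg; have : \forall x \ae lebesgue_rV R d, forall i : 'I_d,
    Omega x -> f x 0 i = g x 0 i by apply: filter_forall.
by apply: filterS => x fgx Ox; apply/rowP => i; exact: fgx.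
Qed.

Lemma dotL2vE f g : L2v Omega f -> L2v Omega g ->
  dotL2v Omega f g =
  \sum_(i < d) dotL2 Omega (fun x => f x 0 i) (fun x => g x 0 i).
Proof.
move=> Lf Lg; rewrite /dotL2v Rintegral_mkcond.
under [RHS]eq_bigr do rewrite dotL2_patch.
rewrite -Rintegral_sum; last by move=> i; exact: L2_integrable.
apply: eq_Rintegral => x _; rewrite /patch.
case: ifP => //= _; rewrite big1// => i _.
exact: mul0r.
Qed.

Lemma dotL2v_combr (a b : R) f g h : L2v Omega f -> L2v Omega g -> L2v Omega h ->
  dotL2v Omega f (fun x => a *: g x + b *: h x) =
  a * dotL2v Omega f g + b * dotL2v Omega f h.
Proof.
move=> Lf Lg Lh; rewrite !dotL2vE//; last exact: L2v_comb.
rewrite !mulr_sumr -big_split /=; apply: eq_bigr => i _.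
by rewrite -dotL2_combr//; congr dotL2; apply/funext => x; rewrite !mxE.
Qed.

Lemma dotL2v_eq_on f g h : L2v Omega f -> L2v Omega g -> L2v Omega h ->
  eq_on Omega g h -> dotL2v Omega f g = dotL2v Omega f h.
Proof.
move=> Lf Lg Lh gh; rewrite !dotL2vE//; apply: eq_bigr => i _.
by apply: dotL2_eq_on => //; apply: filterS gh => x ghx Ox; rewrite ghx.
Qed.

Lemma dotL2_coord_le f i : L2v Omega f ->
  dotL2 Omega (fun x => f x 0 i) (fun x => f x 0 i) <= dotL2v Omega f f.
Proof.
move=> Lf; rewrite dotL2vE// (bigD1 i)//= lerDl.
by apply: sumr_ge0 => j _; exact: dotL2_ge0.
Qed.

Lemma dotL2v_eq0 f : L2v Omega f -> dotL2v Omega f f = 0 ->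
  eq_on Omega f (fun=> 0).
Proof.
move=> Lf f0; apply: eq_on_coord => i.
have : eq_on Omega (fun x => f x 0 i) (fun=> 0).
  apply: dotL2_eq0 => //; apply/eqP; rewrite eq_le dotL2_ge0 andbT -f0.
  exact: dotL2_coord_le.
by apply: filterS => x fx Ox; rewrite fx// mxE.
Qed.

End vector_L2.

(** * Test functions *)

Lemma Lfun2_bounded_support (disp : measure_display)
    (X : measurableType disp) (R : realType) (m : {measure set X -> \bar R})
    (u : X -> R) (A : set X) (M : R) :
  measurable_fun setT u -> measurable A -> (m A < +oo)%E ->
  (forall x, `|u x| <= M) -> (forall x, ~ A x -> u x = 0) ->
  u \in Lfun m 2%:E.
Proof.
move=> mu mA Aoo uM uA; rewrite inE; apply/andP; split; rewrite inE//=.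
rewrite /finite_norm unlock /Lnorm poweR_lty//=.
apply: (@le_lt_trans _ _ (\int[m]_x ((M `^ 2) * \1_A x)%:E)%E).
  apply: ge0_le_integral => //.
  - apply/measurable_EFinP; apply: (measurableT_comp (measurable_powR _)) => //.
    exact: measurableT_comp.
  - by apply/measurable_EFinP/measurable_funM.
  - move=> x _; rewrite lee_fin indicE; have [xA|xA] := boolP (x \in A).
      rewrite mulr1 ge0_ler_powR// nnegrE//.
      exact: le_trans (uM x).
    by rewrite uA ?normr0 ?powR0 ?mulr0//; move: xA; rewrite notin_setE.
under eq_integral do rewrite EFinM.
rewrite ge0_integralZl//; last 2 first.
- exact/measurable_EFinP.
- by rewrite lee_fin powR_ge0.
by rewrite integral_indic// setIT lte_mul_pinfty// lee_fin powR_ge0.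
Qed.

Section test_functions.
Variables (R : realType) (d : nat).
Implicit Types (A Omega : set 'rV[R]_d) (phi : 'rV[R]_d -> R).

Definition rV_box (a b : 'rV[R]_d) : set 'rV[R]_d :=
  [set x | forall i, a 0 i <= x 0 i <= b 0 i].

(** The sigma-algebra on R^d is generated by the coordinates, so Borel sets have
    to be recovered: an open set is a countable union of boxes with rational
    corners. *)
Lemma open_measurable_rV A : open A -> measurable A.
Proof.
move=> oA.
pose box (p : 'rV[rat]_d * 'rV[rat]_d) :=
  rV_box (map_mx ratr p.1) (map_mx ratr p.2).
rewrite (_ : A = \bigcup_p (if `[< box p `<=` A >] then box p else set0)).
  apply: countable_bigcupT_measurable => [|p]; first exact: countableP.
  by case: ifP => _; [exact: measurable_rV_box|exact: measurable0].
apply/seteqP; split=> [x Ax|x [p _]]; last first.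
  by case: ifP => // /asboolP; exact.
have /nbhs_ballP[e /= e0 xeA] : nbhs x A by apply: open_nbhs_nbhs.
have q i : exists p : rat * rat, x 0 i - e < ratr p.1 <= x 0 i /\
    x 0 i <= ratr p.2 < x 0 i + e.
  have /rat_in_itvoo[r] : x 0 i - e < x 0 i by rewrite ltrBlDr ltrDl.
  rewrite in_itv/= => /andP[r1 r2].
  have /rat_in_itvoo[s] : x 0 i < x 0 i + e by rewrite ltrDl.
  rewrite in_itv/= => /andP[s1 s2].
  by exists (r, s) => /=; rewrite r1 s2 !ltW.
have [f fP] := choice q.
exists (\row_i (f i).1, \row_i (f i).2) => //; rewrite asboolT.
  move=> i; rewrite !mxE; have [/andP[_ ->] /andP[-> _]] := fP i.
  by [].
move=> y yb; apply: xeA; split=> // i j; rewrite (ord1 i).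
have := yb j; rewrite !mxE => /andP[y1 y2].
have [/andP[f1 _] /andP[_ f2]] := fP j.
rewrite /ball /= ltr_distl; apply/andP; split; lra.
Qed.

Lemma continuous_measurable_rV phi : continuous phi -> measurable_fun setT phi.
Proof.
move=> /continuousP cphi; apply: (measurability _ (RGenOpens.measurableE R)).
move=> _ [_ [a [b ->] <-]]; rewrite setTI; apply: open_measurable_rV.
exact/cphi/interval_open.
Qed.

Lemma compact_rV_box A : compact A -> exists M : R,
  0 <= M /\ A `<=` rV_box (const_mx (- M)) (const_mx M).
Proof.
move=> /compact_bounded /ex_strict_bound_gt0[M M0 AM].
exists M; split; first exact: ltW.
move=> x /AM /= /ltW xM i; rewrite !mxE -ler_norml.
apply: le_trans xM; rewrite [leRHS]mx_normrE.
exact: (le_bigmax _ (fun ij => `|x ij.1 ij.2|) (0, i)).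
Qed.

Lemma test_function_vanish Omega phi x : test_function Omega phi ->
  ~ Omega x -> phi x = 0.
Proof.
move=> [_ _ sO] Ox; apply: contrapT => /eqP px; apply/Ox/sO.
exact: subset_closure.
Qed.

Lemma smooth_continuous phi : smooth phi -> continuous phi.
Proof. by move=> sphi x; exact: differentiable_continuous (sphi [::] x). Qed.

(** A test function is continuous, hence measurable and bounded on its compact
    support, which lies in a box of finite measure. *)
Lemma test_function_L2 Omega phi : test_function Omega phi -> L2 Omega phi.
Proof.
move=> tphi; have [sphi cpt sO] := tphi; rewrite /L2 /=.
have cphi := smooth_continuous sphi.
have -> : phi \_ Omega = phi.
  apply/funext => x; rewrite /patch; case: ifP => // /negbT.
  by rewrite notin_setE => /(test_function_vanish tphi) ->.
have [K [K0 cK]] := compact_rV_box cpt.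
set S := closure _ in cpt cK.
have phi0 x : ~ S x -> phi x = 0.
  by move=> Sx; apply: contrapT => /eqP px; apply: Sx; exact: subset_closure.
have /compact_bounded/ex_strict_bound_gt0[M M0 SM] : compact (phi @` S).
  by apply: continuous_compact => //; exact: continuous_subspaceT.
apply: (@Lfun2_bounded_support _ _ _ _ phi
  (rV_box (const_mx (- K)) (const_mx K)) M).
- exact: continuous_measurable_rV.
- exact: (measurable_rV_box (const_mx (- K)) (const_mx K)).
- rewrite [X in (X < _)%E]lebesgue_rV_box ?ltry// => i; rewrite !mxE; lra.
- move=> x; have [Sx|/phi0 ->] := pselect (S x); last by rewrite normr0 ltW.
  by apply/ltW/SM; exists x.
- by move=> x /= nx; apply: phi0 => /cK.
Qed.

(** Differentiation does not enlarge the support. This lets the partial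
    derivatives of an approximation of an H0 field be test functions. *)
Lemma test_function_partial Omega phi i : test_function Omega phi ->
  test_function Omega (partial i phi).
Proof.
move=> [sphi cpt sO].
have sub : closure [set x | partial i phi x != 0] `<=`
    closure [set x | phi x != 0].
  (* The right-hand side is closed: it is enough to compare the sets
     before closure, and the derivative vanishes where phi is locally 0. *)
  have -> : closure [set x | phi x != 0] =
      closure (closure [set x | phi x != 0]).
    by apply/closure_id; exact: closed_closure.
  apply: closure_subset => x /=; apply: contraPP => nx.
  apply/negP; rewrite negbK; apply/eqP.
  have phi0 : \near x, phi x = cst 0 x.
    have : nbhs x (~` closure [set x | phi x != 0]).
      apply: open_nbhs_nbhs; split => //.
      exact/closed_openC/closed_closure.
    apply: filterS => y ny /=; apply: contrapT => /eqP py; apply: ny.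
    exact: subset_closure.
  by rewrite /partial (near_eq_derive _ phi0) derive_cst.
split.
- by move=> s x; have := sphi (rcons s i) x; rewrite foldr_rcons.
- exact: subclosed_compact (@closed_closure _ _) cpt sub.
- exact: subset_trans sub sO.
Qed.

End test_functions.

(** * Linearity of the weak gradient *)

Section gradient.
Variables (R : realType) (d : nat) (Omega : set 'rV[R]_d).
Implicit Types u v w : 'rV[R]_d -> R.

Lemma H0_L2 u : H0_grad Omega u -> L2 Omega u.
Proof. by case. Qed.

Lemma H0_L2v_grad u : H0_grad Omega u -> L2v Omega (grad Omega u).
Proof. by case=> _ []. Qed.

Lemma H0_by_parts u phi i : H0_grad Omega u -> test_function Omega phi ->
  dotL2 Omega phi (fun x => grad Omega u x 0 i) =
  - dotL2 Omega (partial i phi) u.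
Proof.
case=> _ [_ +] _ tphi => /(_ phi tphi i).
by rewrite !(dotL2C _ phi) dotL2C => ->; rewrite opprK.
Qed.

(** The i-th component of grad u is an L2 limit of partial derivatives of test
    functions, by density of the latter in H0. A field that is orthogonal to all
    test functions is therefore orthogonal to this component. *)
Lemma grad_orthogonal u g i : H0_grad Omega u -> L2 Omega g ->
  (forall phi, test_function Omega phi -> dotL2 Omega g phi = 0) ->
  dotL2 Omega g (fun x => grad Omega u x 0 i) = 0.
Proof.
move=> Hu Lg g0; have Lgu := H0_L2v_grad Hu.
have [_ _ [phi [tphi _ phiu]]] := Hu.
have tpartial n j := test_function_partial j (tphi n).
apply: (@dotL2_limit _ _ _ _ _ (fun n => partial i (phi n))) => //.
- by move=> n; exact/test_function_L2/tpartial.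
- by move=> n; exact/g0/tpartial.
apply: squeeze_cvgr (cvg_cst 0) phiu; apply: nearW => n.
rewrite dotL2_ge0 /=.
have Le : L2v Omega (classical_grad (phi n) \- grad Omega u).
  move=> j; have := L2_comb 1 (-1) (test_function_L2 (tpartial n j)) (Lgu j).
  by congr L2; apply/funext => x; rewrite !mxE mul1r mulN1r.
have := dotL2_coord_le i Le; congr (_ <= _).
by congr dotL2; apply/funext => x; rewrite !mxE.
Qed.

(** Since grad is a chosen representative, linearity is a uniqueness statement.
    The difference g of the two sides has components orthogonal to every test
    function, by integration by parts; g is itself a combination of gradients of
    H0 fields, so it is orthogonal to itself by [grad_orthogonal]. Density in H0
    thus replaces the fundamental lemma of the calculus of variations. *)
Lemma grad_comb (a b : R) u v w :
  H0_grad Omega u -> H0_grad Omega v -> H0_grad Omega w ->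
  eq_on Omega w (fun x => a * u x + b * v x) ->
  eq_on Omega (grad Omega w)
    (fun x => a *: grad Omega u x + b *: grad Omega v x).
Proof.
move=> Hu Hv Hw wuv; apply: eq_on_coord => i.
pose gi z x := grad Omega z x 0 i.
have Lgi z : H0_grad Omega z -> L2 Omega (gi z) by move/H0_L2v_grad; exact.
have [[Lu Lv] Lw] := (Lgi _ Hu, Lgi _ Hv, Lgi _ Hw).
pose s x := a * gi u x + b * gi v x.
have Ls : L2 Omega s by exact: L2_comb.
pose g x := 1 * gi w x + (-1) * s x.
have Lg : L2 Omega g by exact: L2_comb.
have g0 phi : test_function Omega phi -> dotL2 Omega g phi = 0.
  move=> tphi; have Lphi := test_function_L2 tphi.
  have Lp := test_function_L2 (test_function_partial i tphi).
  rewrite dotL2C !dotL2_combr// !H0_by_parts//.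
  rewrite (dotL2_eq_on Lp (H0_L2 Hw) _ wuv).
    by rewrite dotL2_combr; [ring|exact: Lp|exact: H0_L2|exact: H0_L2].
  by apply: L2_comb; exact: H0_L2.
have gae : eq_on Omega g (fun=> 0).
  apply: dotL2_eq0 => //.
  rewrite [LHS](dotL2_combr 1 (-1) Lg Lw Ls).
  rewrite [dotL2 Omega g s](dotL2_combr a b Lg Lu Lv).
  by rewrite !grad_orthogonal// !(mulr0, addr0).
apply: filterS gae => x gx Ox; have := gx Ox.
rewrite /g mul1r mulN1r => /subr0_eq e; apply: (etrans e).
by rewrite /s !mxE.
Qed.

End gradient.

(** * Finite element spaces *)

Section finite_elements.
Variables (R : realType) (d : nat) (Omega : set 'rV[R]_d) (F : lmodType R).
Variables (X V : set ('rV[R]_d -> F)).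
Hypothesis XV : fe_space Omega X V.

Lemma fe_space_sub : V `<=` X.
Proof. by case: XV => m [b [_ ->]] u []. Qed.

Lemma fe_space_comb (a b : R) u v :
  (forall u v, X u -> X v -> X (fun x => a *: u x + b *: v x)) ->
  V u -> V v -> V (fun x => a *: u x + b *: v x).
Proof.
case: XV => m [e [_ ->]] Xcl [Xu [c cu]] [Xv [c' cv]].
split; first exact: Xcl.
exists (fun i => a * c i + b * c' i).
apply: filterS2 cu cv => x cu cv Ox.
rewrite cu// cv// !scaler_sumr -big_split /=; apply: eq_bigr => i _.
by rewrite scalerDl !scalerA.
Qed.

End finite_elements.

(** * Updates of the two schemes *)

Section updates.
Variables (R : realType) (d : nat) (Omega : set 'rV[R]_d) (rho k dt : R).
Variables (V : set ('rV[R]_d -> R)) (W : set ('rV[R]_d -> 'rV[R]_d)).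
Hypotheses (rho0 : rho != 0) (k0 : k != 0).
Hypotheses (feV : fe_space Omega (F := R^o) (L2 Omega) V).
Hypotheses (VH : V `<=` H0_grad Omega).
Hypotheses (feW : fe_space Omega (L2v Omega) W) (VW : compatible Omega V W).

Local Notation grad := (grad Omega).

Let VL2 v : V v -> L2 Omega v. Proof. by move/VH/H0_L2. Qed.
Let WL2 f : W f -> L2v Omega f. Proof. exact: (fe_space_sub feW). Qed.
Let gradW v : V v -> W (grad v). Proof. by move=> Vv; apply: VW; exists v. Qed.

Let Vcomb (a b : R) u v : V u -> V v -> V (fun x => a * u x + b * v x).
Proof. by apply: (fe_space_comb feV) => *; exact: L2_comb. Qed.

Let Wcomb (a b : R) f g : W f -> W g -> W (fun x => a *: f x + b *: g x).
Proof. by apply: (fe_space_comb feW) => *; exact: L2v_comb. Qed.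

(** The velocity equation determines the new velocity: the difference of two
    candidates is an admissible test field psi. *)
Lemma velocity_update_unique v1 v1' v2 v2' :
  V v1 -> V v1' -> V v2 -> V v2' ->
  (forall psi, V psi -> dotL2 Omega psi (rho \*o (v1' \- v1)) =
                        dotL2 Omega psi (rho \*o (v2' \- v2))) ->
  eq_on Omega v1 v2 -> eq_on Omega v1' v2'.
Proof.
move=> V1 V1' V2 V2' E v12.
pose e x := 1 * v1' x + (-1) * v2' x.
have Ve : V e by exact: Vcomb.
have Le := VL2 Ve.
have expand (u u' : 'rV[R]_d -> R) : V u -> V u' ->
    dotL2 Omega e (rho \*o (u' \- u)) =
    rho * dotL2 Omega e u' + (- rho) * dotL2 Omega e u.
  move=> Vu Vu'; rewrite -dotL2_combr//; [|exact: VL2..].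
  by congr dotL2; apply/funext => x /=; rewrite mulrBr mulNr.
have := E _ Ve; rewrite !expand// (dotL2_eq_on Le (VL2 V1) (VL2 V2) v12).
move=> /addIr/(mulfI rho0) e12.
have eae : eq_on Omega e (fun=> 0).
  apply: dotL2_eq0 => //.
  by rewrite [LHS](dotL2_combr 1 (-1) Le (VL2 V1') (VL2 V2')) e12; ring.
apply: filterS eae => x ex Ox; have := ex Ox.
by rewrite /e mul1r mulN1r => /subr0_eq.
Qed.

(** The compatibility condition puts grad v in W, hence also the residual of the
    strong equation. Testing the weak equation with this residual shows that its
    norm is zero. *)
Lemma strong_stress_update v sigma n :
  mixed_scheme Omega V W rho k dt v sigma ->
  eq_on Omega (sigma n.+1) (fun x => sigma n x + (k * dt) *: grad (v n.+1) x).
Proof.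
case=> Vv Ws _ weak.
have Wg := gradW (Vv n.+1).
pose diff x := 1 *: sigma n.+1 x + (-1) *: sigma n x.
have Wdiff : W diff by exact: Wcomb.
pose xi x := 1 *: diff x + (- (k * dt)) *: grad (v n.+1) x.
have Wxi : W xi by exact: Wcomb.
have Lxi := WL2 Wxi.
have weak_diff :
    dotL2v Omega xi diff = k * (dt * dotL2v Omega xi (grad (v n.+1))).
  (* The zero coefficient puts the field in the form of [dotL2v_combr]. *)
  rewrite -weak// (_ : (fun x => k^-1 *: _) =
      (fun x => k^-1 *: diff x + 0 *: diff x)); last first.
    by apply/funext => x; rewrite scale0r addr0 /diff scale1r scaleN1r.
  rewrite [in RHS]dotL2v_combr//; [|exact: WL2..].
  by rewrite mul0r addr0 mulVKf.
have xiae : eq_on Omega xi (fun=> 0).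
  apply: dotL2v_eq0 => //.
  rewrite [LHS](dotL2v_combr 1 (- (k * dt)) Lxi (WL2 Wdiff) (WL2 Wg)).
  by rewrite weak_diff; ring.
apply: filterS xiae => x xix Ox; have := xix Ox.
rewrite /xi /diff !scale1r scaleN1r scaleNr => /subr0_eq <-.
by rewrite addrC subrK.
Qed.

Lemma grad_position_update q q' v : V q -> V q' -> V v ->
  eq_on Omega q' (fun x => q x + dt * v x) ->
  eq_on Omega (grad q') (fun x => grad q x + dt *: grad v x).
Proof.
move=> Vq Vq' Vv qq'.
have := @grad_comb _ _ _ 1 dt q v q' (VH Vq) (VH Vv) (VH Vq').
under eq_fun do rewrite mul1r.
by move=> /(_ qq'); under eq_fun do rewrite scale1r.
Qed.

Lemma eq_on_grad u v : V u -> V v -> eq_on Omega u v ->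
  eq_on Omega (grad u) (grad v).
Proof.
move=> Vu Vv uv.
have := @grad_comb _ _ _ 1 0 v v u (VH Vv) (VH Vv) (VH Vu).
under eq_fun do rewrite mul1r mul0r addr0.
by move=> /(_ uv); under eq_fun do rewrite scale1r scale0r addr0.
Qed.

Lemma lagrangian_position v q n : lagrangian_scheme Omega V rho k dt v q ->
  eq_on Omega (q n.+1) (fun x => q n x + dt * v n.+1 x).
Proof.
case=> _ _ _ /(_ n); apply: filterS => x /[apply] /= <-.
by rewrite addrC subrK.
Qed.

(** Under the identification of the average velocity with the velocity at the
    half-integer time, the trapezoidal rule is the position update of the Lagrangian
    scheme. *)
Lemma trapezoidal_position v vbar q n :
  trapezoidal_reconstruction Omega V dt v vbar q ->
  eq_on Omega (q n.+1) (fun x => q n x + dt * v n.+1 x).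
Proof.
case=> _ _ /(_ n) vE /(_ n); apply: filterS2 vE => x vE qE Ox.
by rewrite qE// -vE//; congr (_ + _); ring.
Qed.

(** The strong stress update is k times the gradient of the position update, so
    the identity sigma = k grad q is preserved by every step. *)
Lemma stress_propagates v q sigma :
  mixed_scheme Omega V W rho k dt v sigma -> (forall n, V (q n)) ->
  (forall n, eq_on Omega (q n.+1) (fun x => q n x + dt * v n.+1 x)) ->
  eq_on Omega (sigma 0%N) (fun x => k *: grad (q 0%N) x) ->
  forall n, eq_on Omega (sigma n) (fun x => k *: grad (q n) x).
Proof.
move=> M Vq qE s0; elim=> [|n IH]; first exact: s0.
have [Vv _ _ _] := M.
have gE := grad_position_update (Vq n) (Vq n.+1) (Vv n.+1) (qE n).
have sE := strong_stress_update n M.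
apply: filterS3 IH gE sE => x IH gE sE Ox.
by rewrite sE// gE// IH// scalerDr scalerA.
Qed.

Lemma kgrad_L2v u : V u -> L2v Omega (fun x => k *: grad u x).
Proof.
move=> Vu; have := L2v_comb k 0 (WL2 (gradW Vu)) (WL2 (gradW Vu)).
by congr L2v; apply/funext => x; rewrite scale0r addr0.
Qed.

(** The stress update holds strongly for k grad q, hence also when tested against
    W. *)
Lemma lagrangian_to_mixed v q : lagrangian_scheme Omega V rho k dt v q ->
  mixed_scheme Omega V W rho k dt v (fun n x => k *: grad (q n) x).
Proof.
move=> L; have [Vv Vq vE _] := L; split => // [n|n xi Wxi].
  have := Wcomb k 0 (gradW (Vq n)) (gradW (Vq n)); congr W.
  by apply/funext => x; rewrite scale0r addr0.
have gE := grad_position_update (Vq n) (Vq n.+1) (Vv n.+1)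
  (lagrangian_position n L).
have Lg u : V u -> L2v Omega (grad u) by move/gradW/WL2.
have [Lxi Lv] := (WL2 Wxi, Lg _ (Vv n.+1)).
have Lc a b u w : V u -> V w ->
    L2v Omega (fun x => a *: grad u x + b *: grad w x).
  by move=> Vu Vw; apply: L2v_comb; exact: Lg.
have -> : dt * dotL2v Omega xi (grad (v n.+1)) =
    dotL2v Omega xi (fun x => dt *: grad (v n.+1) x + 0 *: grad (v n.+1) x).
  by rewrite dotL2v_combr// mul0r addr0.
apply: dotL2v_eq_on => //; last 2 first.
- exact: Lc.
- apply: filterS gE => x gE Ox.
  rewrite gE// -scalerBr scalerA mulVf// scale1r scale0r addr0.
  by rewrite addrC addKr.
have := Lc 1 (-1) _ _ (Vq n.+1) (Vq n); congr L2v; apply/funext => x.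
by rewrite -scalerBr scalerA mulVf// !scale1r scaleN1r.
Qed.

Lemma mixed_to_lagrangian v vbar q sigma :
  mixed_scheme Omega V W rho k dt v sigma ->
  trapezoidal_reconstruction Omega V dt v vbar q ->
  eq_on Omega (sigma 0%N) (fun x => k *: grad (q 0%N) x) ->
  lagrangian_scheme Omega V rho k dt v q.
Proof.
move=> M T s0; have [Vv Ws vE _] := M; have [_ Vq _ _] := T.
have qE n := trapezoidal_position n T.
have sE := stress_propagates M Vq qE s0.
split => // [n psi Vpsi|n].
  rewrite vE//; congr (_ * _); apply: dotL2v_eq_on => //.
  - exact/WL2/gradW.
  - exact: WL2.
  - exact: kgrad_L2v.
by apply: filterS (qE n) => x qEx Ox /=; rewrite qEx// addrC addKr.
Qed.

(** One induction for all three fields: the stresses at step n give the velocities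
    at step n + 1, and these give the stresses and positions at step n + 1. *)
Lemma schemes_agree vL qL vM vbarM qM sigmaM :
  lagrangian_scheme Omega V rho k dt vL qL ->
  mixed_scheme Omega V W rho k dt vM sigmaM ->
  trapezoidal_reconstruction Omega V dt vM vbarM qM ->
  eq_on Omega (vM 0%N) (vL 0%N) ->
  eq_on Omega (sigmaM 0%N) (fun x => k *: grad (qL 0%N) x) ->
  eq_on Omega (qM 0%N) (qL 0%N) ->
  forall n, [/\ eq_on Omega (sigmaM n) (fun x => k *: grad (qL n) x),
                eq_on Omega (vM n) (vL n) & eq_on Omega (qM n) (qL n)].
Proof.
move=> L M T v0 s0 q0; elim=> [|n [sn vn qn]]; first by split.
have [VvL VqL vLE _] := L; have [VvM Ws vME _] := M.
have v' : eq_on Omega (vM n.+1) (vL n.+1).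
  apply: velocity_update_unique vn => // psi Vpsi.
  rewrite vLE// vME//; congr (_ * _); apply: dotL2v_eq_on => //.
  - exact/WL2/gradW.
  - exact: WL2.
  - exact: kgrad_L2v.
have qLE := lagrangian_position n L.
split; [|exact: v'|].
- have gE := grad_position_update (VqL n) (VqL n.+1) (VvL n.+1) qLE.
  have gv := eq_on_grad (VvM n.+1) (VvL n.+1) v'.
  have sE := strong_stress_update n M.
  (* The stress is driven by vM, but the gradient to match is that of qL. *)
  have gs : eq_on Omega (sigmaM n.+1)
      (fun x => sigmaM n x + (k * dt) *: grad (vL n.+1) x).
    by apply: filterS2 sE gv => x sE gv Ox;
      rewrite (sE Ox) (gv Ox).
  apply: filterS3 sn gE gs => x sn gE gs Ox.
  by rewrite gs// gE// sn// scalerDr scalerA.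
- apply: filterS3 (trapezoidal_position n T) qLE (filterI qn v').
  move=> x qM' qL' [qn' vn'] Ox.
  by rewrite qM'// qL'// qn'// vn'.
Qed.

End updates.

(** * Equivalence of the schemes *)

Theorem proposition1 (R : realType) (d : nat) (Omega : set 'rV[R]_d)
    (rho k dt : R)
    (V : set ('rV[R]_d -> R)) (W : set ('rV[R]_d -> 'rV[R]_d)) :
  open Omega ->
  rho != 0 -> k != 0 ->
  fe_space Omega (F := R^o) (L2 Omega) V -> V `<=` H0_grad Omega ->
  fe_space Omega (L2v Omega) W ->
  compatible Omega V W ->
  [/\ (* two solutions with the same initial data agree at all times *)
      forall (vL qL vM vbarM qM : nat -> 'rV[R]_d -> R)
        (sigmaM : nat -> 'rV[R]_d -> 'rV[R]_d),
        lagrangian_scheme Omega V rho k dt vL qL ->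
        mixed_scheme Omega V W rho k dt vM sigmaM ->
        trapezoidal_reconstruction Omega V dt vM vbarM qM ->
        eq_on Omega (vM 0%N) (vL 0%N) ->
        eq_on Omega (sigmaM 0%N) (fun x => k *: grad Omega (qL 0%N) x) ->
        eq_on Omega (qM 0%N) (qL 0%N) ->
        forall n, [/\ eq_on Omega (sigmaM n) (fun x => k *: grad Omega (qL n) x),
                      eq_on Omega (vM n) (vL n) &
                      eq_on Omega (qM n) (qL n)],
      (* every solution of (L) yields one of (M) *)
      forall v q : nat -> 'rV[R]_d -> R,
        lagrangian_scheme Omega V rho k dt v q ->
        mixed_scheme Omega V W rho k dt v
          (fun n x => k *: grad Omega (q n) x) &
      (* every solution of (M) yields one of (L) *)
      forall (v vbar q : nat -> 'rV[R]_d -> R)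
        (sigma : nat -> 'rV[R]_d -> 'rV[R]_d),
        mixed_scheme Omega V W rho k dt v sigma ->
        trapezoidal_reconstruction Omega V dt v vbar q ->
        eq_on Omega (sigma 0%N) (fun x => k *: grad Omega (q 0%N) x) ->
        lagrangian_scheme Omega V rho k dt v q].
Proof.
move=> _ rho0 k0 feV VH feW VW; split.
- by move=> vL qL vM vbarM qM sigmaM; exact: (schemes_agree rho0 k0 feV VH feW VW).
- by move=> v q; exact: (lagrangian_to_mixed k0 VH feW VW).
- move=> v vbar q sigma; exact: (mixed_to_lagrangian k0 VH feW VW).
Qed.
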